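(* For $\sigma\in S_n(132)$, let $L^{U^2D}_n(\sigma)$ denote the length of the longest subsequence of $\sigma$ that repeats the up/down pattern $UUD$ (so $L^{U^2D}_n(\sigma)$ is either equal to $0$ or to $3k+1$ for some $k\in\mathbb{N}$). Then $$E_n^{\text{av}(132)}L^{U^2D}_n\sim\frac37 n \quad\text{as } n\to\infty.$$
   Context: $S_n$ is the set of permutations $\sigma=\sigma_1\cdots\sigma_n$ of $[n]=\{1,\dots,n\}$. A permutation $\sigma\in S_n$ avoids $\tau\in S_3$ if there are no indices $i_1<i_2<i_3$ such that $\sigma_{i_1}\sigma_{i_2}\sigma_{i_3}$ is in the same relative order as $\tau_1\tau_2\tau_3$; $S_n(\tau)$ is the set of $\sigma\in S_n$ avoiding $\tau$. $P_n^{\text{av}(\tau)}$ is the uniform probability measure on $S_n(\tau)$ and $E_n^{\text{av}(\tau)}$ is the corresponding expectation. To a subsequence $\sigma_{i_1},\dots,\sigma_{i_m}$ ($i_1<\cdots<i_m$, $m\ge 2$) of $\sigma$ associate the up/down sequence $V_1\cdots V_{m-1}$, where $V_j=U$ if $\sigma_{i_{j+1}}>\sigma_{i_j}$ and $V_j=D$ if $\sigma_{i_{j+1}}<\sigma_{i_j}$. For a fixed up/down pattern $W=W_1\cdots W_l$ with $W_j\in\{U,D\}$, a subsequence repeats the pattern $W$ if its up/down sequence is $W$ concatenated with itself $k$ times for some $k\in\mathbb{N}=\{1,2,\dots\}$ (so it has length $kl+1$; incomplete patterns are not counted). The length of the longest subsequence repeating $W$ is the maximum such $kl+1$, and is $0$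 if no such subsequence exists. The notation $x_n\sim y_n$ means $x_n/y_n\to1$ as $n\to\infty$. *)

(* Defs.v *)
From mathcomp Require Import all_boot all_order all_algebra perm.
From mathcomp Require Import boolp reals.
Set Implicit Arguments.
Unset Strict Implicit.
Unset Printing Implicit Defensive.
Import GRing.Theory.

(* Permutations of [n] are elements of 'S_n, i.e. of {perm 'I_n}; positions and
   values are both shifted by one, to {0, ..., n-1}. *)

Definition contains (k n : nat) (t : 'S_k) (s : 'S_n) : bool :=
  [exists f : {ffun 'I_k -> 'I_n},
    [forall a : 'I_k, forall b : 'I_k, (a < b) ==> (f a < f b)] &&
    [forall a : 'I_k, forall b : 'I_k, (s (f a) < s (f b)) == (t a < t b)]].

Definition Sav (k n : nat) (t : 'S_k) : {set 'S_n} :=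
  finset (fun s => ~~ contains t s).

Definition p132 : 'S_3 := tperm (Ordinal (isT : 1 < 3)) (Ordinal (isT : 2 < 3)).

Lemma p132E : [seq (p132 i : nat).+1 | i <- enum 'I_3] = [:: 1; 3; 2].
Proof.
rewrite !enum_ordSl enum_ord0 /= /p132 tpermD //.
rewrite (_ : lift ord0 ord0 = Ordinal (isT : 1 < 3)); last exact/val_inj.
rewrite (_ : lift _ (lift _ _) = Ordinal (isT : 2 < 3)); last exact/val_inj.
by rewrite tpermL tpermR.
Qed.

Definition U : bool := true.
Definition D : bool := false.

Definition updown (w : seq nat) : seq bool :=
  if w is x :: w' then pairmap (fun a b => a < b) x w' else [::].

(* The subsequence of s at the set A of positions; [enum A] is increasing. *)
Definition subword (n : nat) (s : 'S_n) (A : {set 'I_n}) : seq nat :=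
  [seq (s i : nat) | i <- enum A].

Definition repeats (W : seq bool) (w : seq nat) : Prop :=
  exists2 k, 0 < k & updown w = flatten (nseq k W).

(* [\max] over an empty family of natural numbers is 0. *)
Definition longest_repeat (W : seq bool) (n : nat) (s : 'S_n) : nat :=
  \max_(A : {set 'I_n} | `[< repeats W (subword s A) >]) size (subword s A).

Local Open Scope ring_scope.

Definition uniform_prob (R : realType) (T : finType) (S : {set T}) (x : T) : R :=
  if x \in S then #|S|%:R^-1 else 0.

Definition Eav (R : realType) (k n : nat) (t : 'S_k) (X : 'S_n -> R) : R :=
  \sum_(s : 'S_n) uniform_prob R (Sav n t) s * X s.

(* Main.v *)
(* A nonempty 132-avoiding permutation is L n R with every letter of L above
   every letter of R, so 132-avoiding permutations correspond to binary trees.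
   Let M be the maximal length of a subsequence whose up/down sequence is a
   prefix of UUDUUD...  A descent is forced between L n and R, so M(L n R) is
   determined by M(L) and M(R), and K = floor(M / 3) is an additive functional:
   K(L n R) = K(L) + K(R) + [M(L) = 2 mod 3].  The longest subsequence repeating
   UUD differs from 3K by at most 3.

   Let C be the generating function of the Catalan numbers c_n.  If h is the toll
   of K and H its generating function, the sum of K over trees of size n is the
   n-th coefficient of H / (1 - 2xC), and 1 / (1 - 2xC) has coefficients
   (n + 1) c_n.  Normalised by 4^n these decrease to 0, which forces the mean of
   K to be asymptotic to H(1/4) n.  At x = 1/4 the recursion for M mod 3 becomes
   a linear system, whose solution gives H(1/4) = 1/7. *)

Require Import Defs.
From HB Require Import structures.
From mathcomp Require Import all_boot all_order all_algebra perm.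
From mathcomp Require Import all_classical all_reals all_analysis.
From mathcomp Require Import zify ring lra.
Set Implicit Arguments.
Unset Strict Implicit.
Unset Printing Implicit Defensive.
Import Order.TTheory GRing.Theory Num.Theory.
Import numFieldNormedType.Exports.

(** * Subsequences following UUDUUD... *)

Lemma subseq_cat_split (T : eqType) (u w1 w2 : seq T) :
  subseq u (w1 ++ w2) ->
  exists u1 u2, [/\ u = u1 ++ u2, subseq u1 w1 & subseq u2 w2].
Proof.
elim: w1 u => [|x w1 IH] u /=; first by move=> uw; exists [::], u.
case: u => [|y u]; first by exists [::], [::]; rewrite !sub0seq.
case: ifP => [/eqP ->|xy] /IH[u1 [u2 [eu s1 s2]]].
  by exists (x :: u1), u2; rewrite eu /= eqxx.
exists u1, u2; split=> //; case: u1 eu s1 => [|z u1] //= [<- _].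
by rewrite xy.
Qed.

(* The up/down sequence of [u] is a prefix of UUDUUD... *)
Definition uud (u : seq nat) : Prop :=
  forall i, i.+1 < size u -> (nth 0 u i < nth 0 u i.+1) = (i %% 3 != 2).

(** The step from [u] to [v] is a descent, and its index [(size u).-1] may carry one only if it is 2
    mod 3. Then [v] starts at phase 0 again. *)
Lemma uud_cat (u v : seq nat) : u != [::] -> v != [::] ->
  (forall x y, x \in u -> y \in v -> y < x) ->
  uud (u ++ v) <-> [/\ uud u, 3 %| size u & uud v].
Proof.
move=> u_neq0 v_neq0 vu.
have u0 : 0 < size u by rewrite lt0n size_eq0.
have v0 : 0 < size v by rewrite lt0n size_eq0.
have lastu i : i < size u -> nth 0 u i \in u by exact: mem_nth.
have firstv i : i < size v -> nth 0 v i \in v by exact: mem_nth.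
split=> [uv|[uu d3 vv] i].
  split=> [i iu|| i iv].
  - have := uv i; rewrite !nth_cat size_cat iu (ltnW iu); apply.
    by rewrite ltn_addr.
  - have := uv (size u).-1 ltac:(rewrite size_cat; lia).
    rewrite !nth_cat prednK // ltnn subnn leqnn.
    have := vu _ _ (lastu (size u).-1 ltac:(lia)) (firstv 0 v0); lia.
  - have := uv (size u + i) ltac:(rewrite size_cat; lia); rewrite !nth_cat.
    have -> : (size u + i < size u) = false by lia.
    have -> : ((size u + i).+1 < size u) = false by lia.
    have -> : size u + i - size u = i by lia.
    have -> : (size u + i).+1 - size u = i.+1 by lia.
    move=> E.
    suff: 3 %| size u by move=> ?; rewrite E; congr (_ != _); lia.
    have := uv (size u).-1 ltac:(rewrite size_cat; lia).
    rewrite !nth_cat prednK // ltnn subnn leqnn.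
    have := vu _ _ (lastu (size u).-1 ltac:(lia)) (firstv 0 v0); lia.
rewrite size_cat !nth_cat => iuv.
case: (ltngtP i.+1 (size u)) => iu.
- by rewrite uu.
- have -> : i.+1 - size u = (i - size u).+1 by lia.
  rewrite vv; last lia.
  by congr (_ != _); lia.
- rewrite -iu subnn.
  have lt := vu _ _ (lastu i ltac:(lia)) (firstv 0 v0).
  lia.
Qed.

Lemma uud_rcons (u : seq nat) x : u != [::] -> (forall y, y \in u -> y < x) ->
  uud (rcons u x) <-> uud u /\ ~~ (3 %| size u).
Proof.
move=> u_neq0 ux; have u0 : 0 < size u by rewrite lt0n size_eq0.
have lastu : nth 0 u (size u).-1 < x by apply/ux/mem_nth; rewrite prednK.
split=> [uv|[uu d3] i].
  split=> [i iu|].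
  - have := uv i; rewrite !nth_rcons size_rcons iu (ltnW iu); apply; lia.
  - have := uv (size u).-1 ltac:(rewrite size_rcons; lia).
    rewrite !nth_rcons prednK // ltnn eqxx leqnn; lia.
rewrite size_rcons !nth_rcons => iuv.
case: (ltngtP i.+1 (size u)) => iu; [by rewrite uu|lia|].
by move: d3 lastu; rewrite -iu /=; lia.
Qed.

Definition reach (w : seq nat) (m : nat) : Prop :=
  exists u, [/\ subseq u w, size u = m & uud u].

Lemma subseq_reach (u w : seq nat) : subseq u w -> uud u -> reach w (size u).
Proof. by exists u. Qed.

Lemma reach_addn k w m : reach (map (addn k) w) m <-> reach w m.
Proof.
have sh u : uud (map (addn k) u) <-> uud u.
  split=> uu i iu.
    have := uu i; rewrite size_map !(nth_map 0) ?ltn_add2l //; last exact: ltnW.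
    by apply.
  rewrite size_map in iu.
  by rewrite !(nth_map 0) ?ltn_add2l ?uu //; exact: ltnW.
split=> [[u [/subseqP[b sb ->] sz uu]]|[u [uw sz uu]]].
  exists (mask b w); split; [exact: mask_subseq| |].
    by rewrite -sz -map_mask size_map.
  by apply/sh; rewrite map_mask.
by exists (map (addn k) u); split; [exact: map_subseq|rewrite size_map|exact/sh].
Qed.

(* A new maximum can be appended unless the next step must be a descent. *)
Definition push_max (m : nat) : nat := if (0 < m) && (3 %| m) then m else m.+1.

(** A prefix of an admissible subsequence is admissible, so the reachable lengths form an initial
    segment. Describing it by one equivalence packs the upper bound and its attainment together and
    lets both pass through an induction. *)
Lemma reach_rcons (w : seq nat) x M : (forall y, y \in w -> y < x) ->
  (forall m, reach w m <-> m <= M) ->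
  forall m, reach (rcons w x) m <-> m <= push_max M.
Proof.
move=> wx wM m; rewrite /push_max; split.
  case=> u [+ <- +]; rewrite -cats1 => /subseq_cat_split[u1 [u2 [-> s1 s2]]].
  have [->|u10] := eqVneq u1 [::].
    move=> _; apply: leq_trans (size_subseq s2) _ => /=.
    by case: ifP; lia.
  case: u2 s2 => [|y [|z u2]] s2; last by have := size_subseq s2.
    rewrite cats0 => /(subseq_reach s1)/wM.
    by move: (size u1) => k; case: ifP; lia.
  move: s2; rewrite sub1seq inE cats1 size_rcons => /eqP->.
  have u1x z : z \in u1 -> z < x by move=> /(mem_subseq s1); exact: wx.
  move=> /(uud_rcons u10 u1x)[/(subseq_reach s1)/wM].
  by move: (size u1) => k; case: ifP; lia.
move=> mM.
have [/wM[u [s1 sz uu]]|Mm] := leqP m M.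
  by exists u; split=> //; apply: subseq_trans s1 (subseq_rcons _ _).
have em : m = M.+1 by move: mM; case: ifP; lia.
(* Although 3 divides 0, a first letter makes no step, so it can always be taken. *)
have [M0|M0] := posnP M.
  exists [:: x]; split; last by case.
    by rewrite sub1seq mem_rcons inE eqxx.
  by rewrite em M0.
have /wM[u [s1 sz uu]] := leqnn M.
exists (rcons u x); split.
- by rewrite -!cats1 cat_subseq.
- by rewrite size_rcons sz.
- have u0 : u != [::] by apply: contraTneq M0 => u0; rewrite -sz u0.
  apply/(uud_rcons u0); first by move=> z /(mem_subseq s1); exact: wx.
  by split=> //; rewrite sz; move: mM; rewrite em M0 /=; case: ifP => //; lia.
Qed.

(* A descent is forced where one passes to the lower block, so the part before it
   consists of whole copies of UUD. *)
Definition push_below (m1 m2 : nat) : nat := maxn m1 (3 * (m1 %/ 3) + m2).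

Lemma reach_cat (w1 w2 : seq nat) M1 M2 :
  (forall x y, x \in w1 -> y \in w2 -> y < x) ->
  (forall m, reach w1 m <-> m <= M1) -> (forall m, reach w2 m <-> m <= M2) ->
  forall m, reach (w1 ++ w2) m <-> m <= push_below M1 M2.
Proof.
move=> w21 wM1 wM2 m; rewrite /push_below; split.
  case=> u [+ <- +] => /subseq_cat_split[u1 [u2 [-> s1 s2]]].
  have [->|u10] := eqVneq u1 [::].
    by move=> /(subseq_reach s2)/wM2 /=; move: (size u2) => k; lia.
  have [->|u20] := eqVneq u2 [::].
    by rewrite cats0 => /(subseq_reach s1)/wM1; move: (size u1) => k; lia.
  have u21 x y : x \in u1 -> y \in u2 -> y < x.
    by move=> /(mem_subseq s1) + /(mem_subseq s2); exact: w21.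
  move=> /(uud_cat u10 u20 u21)[/(subseq_reach s1)/wM1 + + /(subseq_reach s2)/wM2].
  by rewrite size_cat; move: (size u1) (size u2) => k1 k2; lia.
move=> mM.
have [/wM1[u [s1 sz uu]]|Mm] := leqP m M1.
  by exists u; split=> //; apply: subseq_trans s1 (prefix_subseq _ _).
have /wM1[u1 [s1 sz1 uu1]] : 3 * (M1 %/ 3) <= M1 by lia.
have /wM2[u2 [s2 sz2 uu2]] : m - 3 * (M1 %/ 3) <= M2 by lia.
exists (u1 ++ u2); split.
- exact: cat_subseq.
- by rewrite size_cat sz1 sz2; lia.
- have [->//|u10] := eqVneq u1 [::].
  have u20 : u2 != [::] by apply: contraTneq Mm => u20; rewrite u20 /= in sz2; lia.
  apply/uud_cat => //; last by split=> //; rewrite sz1; lia.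
  by move=> x y /(mem_subseq s1) + /(mem_subseq s2); exact: w21.
Qed.

Inductive tree := Leaf | Node of tree & tree.

Fixpoint nodes (t : tree) : nat :=
  if t is Node l r then (nodes l + nodes r).+1 else 0.

Fixpoint tword (t : tree) : seq nat :=
  if t is Node l r then
    map (addn (nodes r)) (tword l) ++ nodes l + nodes r :: tword r
  else [::].

Fixpoint maxuud (t : tree) : nat :=
  if t is Node l r then push_below (push_max (maxuud l)) (maxuud r) else 0.

Lemma size_tword t : size (tword t) = nodes t.
Proof. by elim: t => //= l IHl r IHr; rewrite size_cat size_map /= IHl IHr addnS. Qed.

Lemma tword_lt t x : x \in tword t -> x < nodes t.
Proof.
elim: t x => //= l IHl r IHr x; rewrite mem_cat inE.
case/or3P=> [/mapP[y /IHl ? ->]|/eqP->|/IHr]; lia.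
Qed.

Lemma reach_tword t m : reach (tword t) m <-> m <= maxuud t.
Proof.
elim: t m => [m|l IHl r IHr m] /=.
  split=> [[u [us <- _]]|]; first exact: (size_subseq us).
  by rewrite leqn0 => /eqP->; exists [::]; split.
(* L n R is read as (L n) R: the maximum is appended to L first, and R lies below both. *)
rewrite -cat_rcons; apply: reach_cat => //.
  move=> x y; rewrite mem_rcons inE => /orP[/eqP->|/mapP[z _ ->]] /tword_lt; lia.
apply: reach_rcons => [y /mapP[z /tword_lt ? ->]|p]; first by lia.
by rewrite reach_addn.
Qed.

Lemma maxuud_eq0 t : (maxuud t == 0) = (nodes t == 0).
Proof. by case: t => //= l r; rewrite /push_below /push_max; case: ifP; lia. Qed.

(** * Binary trees and 132-avoiding permutations *)

Definition tree_eq_dec : comparable tree.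
Proof. by move=> s t; rewrite /decidable; decide equality. Defined.

HB.instance Definition _ := comparableMixin tree_eq_dec.

Definition av132 (w : seq nat) : Prop :=
  forall a b c, subseq [:: a; b; c] w -> ~~ (a < c < b).

Definition is_perm_word (w : seq nat) : bool :=
  uniq w && all (fun x => x < size w) w.

Lemma tword_perm t : is_perm_word (tword t).
Proof.
rewrite /is_perm_word size_tword; apply/andP; split; last first.
  by apply/allP => x; exact: tword_lt.
elim: t => //= l IHl r IHr; rewrite cat_uniq /= IHr.
rewrite map_inj_uniq ?IHl /=; last exact: addnI.
have -> /= : nodes l + nodes r \notin tword r.
  by apply/negP => /tword_lt; lia.
rewrite andbT negb_or; apply/andP; split.
  by apply/negP => /mapP[x /tword_lt]; lia.
by apply/hasPn => x /tword_lt xr; apply/negP => /mapP[y]; lia.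
Qed.

Lemma tword_av132 t : av132 (tword t).
Proof.
elim: t => //= l IHl r IHr a b c.
have lr x : x \in map (addn (nodes r)) (tword l) ->
    nodes r <= x < nodes l + nodes r.
  by case/mapP=> y /tword_lt ? ->; lia.
move=> /subseq_cat_split[u1 [u2 [eu s1 s2]]].
(* Cases by the number of letters of the pattern that fall in the left block: with none or all
   three, induction applies unless [a] is the maximum; with one, [c] lies below [a]; with two, [c]
   is the maximum or lies below [a]. *)
case: u1 eu s1 => [|x [|y [|z [|? ?]]]] //=; rewrite ?sub0seq.
- move=> eu _; move: s2; rewrite -{}eu /=; case: eqP => [->|_] s2.
    have /allP/= := mem_subseq s2; rewrite andbT => /andP[/tword_lt ? /tword_lt].
    by lia.
  exact: IHr.
- case=> -> eu; rewrite sub1seq => /lr al; move: s2; rewrite -{}eu /=.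
  case: ifP => _ s2; have /allP/= := mem_subseq s2; rewrite andbT.
    by move/tword_lt; lia.
  by case/andP=> _ /tword_lt; lia.
- case=> -> -> eu s1; move: s2; rewrite -{}eu sub1seq inE.
  have /allP/= := mem_subseq s1; rewrite andbT => /andP[/lr ? /lr ?].
  by move=> /orP[/eqP->|/tword_lt]; lia.
- case=> -> -> -> _ s1; have /subseqP[m _ em] := s1.
  move: em; rewrite -map_mask.
  case em: (mask m (tword l)) => [|a' [|b' [|c' [|? ?]]]] //= [-> -> ->].
  rewrite !ltn_add2l; apply: IHl; rewrite -em; exact: mask_subseq.
Qed.

(** The maximum occurs only once, so its index reveals the size of the left subtree, and equal words
    split at the same place. *)
Lemma tword_inj : injective tword.
Proof.
elim=> [|l IHl r IHr] [|l' r'] //=; try by case: (map _ _).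
move=> e; have := congr1 size e.
rewrite !size_cat /= !size_map !size_tword !addnS => -[en].
have nin t1 t2 : nodes t1 + nodes t2 \notin map (addn (nodes t2)) (tword t1).
  by apply/negP => /mapP[x /tword_lt]; lia.
have idx t1 t2 : index (nodes t1 + nodes t2)
    (map (addn (nodes t2)) (tword t1) ++ nodes t1 + nodes t2 :: tword t2) = nodes t1.
  by rewrite index_cat (negPf (nin _ _)) /= eqxx addn0 size_map size_tword.
have el : nodes l = nodes l' by rewrite -(idx l r) e en idx.
have er : nodes r = nodes r' by lia.
move/eqP: e; rewrite eqseq_cat ?size_map ?size_tword // => /andP[/eqP e1 /eqP[_ e2]].
rewrite (IHr _ e2); congr Node; apply: IHl.
by move: e1; rewrite er => /(inj_map (@addnI _)).
Qed.

Lemma av132_subseq u w : subseq u w -> av132 w -> av132 u.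
Proof. by move=> uw av a b c /subseq_trans/(_ uw)/av. Qed.

Lemma av132_addn k w : av132 (map (addn k) w) -> av132 w.
Proof.
by move=> av a b c /(map_subseq (addn k))/av; rewrite !ltn_add2l.
Qed.

Lemma mem_perm_word w x : is_perm_word w -> (x \in w) = (x < size w).
Proof.
case/andP=> uw /allP bw.
have ws : {subset w <= iota 0 (size w)} by move=> y /bw; rewrite mem_iota.
have [_ ->] := uniq_min_size uw ws ltac:(by rewrite size_iota).
by rewrite mem_iota.
Qed.

Lemma tword_onto w : is_perm_word w -> av132 w -> exists t, tword t = w.
Proof.
have [k] := ubnP (size w); elim: k w => // k IH w wk pw av.
case: (posnP (size w)) => [/size0nil->|w0]; first by exists Leaf.
move em : (size w).-1 => m.
have sw : size w = m.+1 by rewrite -em prednK.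
have mw : m \in w by rewrite mem_perm_word // sw.
have [w1 [w2 ew]] : exists w1 w2, w = w1 ++ m :: w2.
  by case/splitPr: mw => w1 w2; exists w1, w2.
have inw x : (x \in w) = (x < m.+1) by rewrite mem_perm_word // sw.
case/andP: pw; rewrite ew cat_uniq /= negb_or.
case/and3P=> u1 /andP[mw1 /hasPn w12] /andP[mw2 u2] _.
(* With [x < y], the letters [x], [m], [y] would form the pattern 132. *)
have w21 x y : x \in w1 -> y \in w2 -> y < x.
  move=> xw1 yw2.
  have /av : subseq [:: x; m; y] w.
    by rewrite ew (@cat_subseq _ [:: x]) ?sub1seq //= eqxx sub1seq.
  have : y \in w by rewrite ew mem_cat inE yw2 !orbT.
  have : y != m by apply: contraNneq mw2 => <-.
  have : y != x by apply: contraNneq (w12 _ yw2) => ->.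
  by rewrite inw; lia.
(* All values up to [y] lie below every letter of [w1], hence belong to [w2], which therefore has
   more than [y] letters. Conversely all of [w2] lies below each letter of [w1], which gives [ge1];
   so [w2] and the lowered [w1] are words of permutations. *)
have lt2 y : y \in w2 -> y < size w2.
  move=> yw2; have /uniq_leq_size : {subset iota 0 y.+1 <= w2}.
    move=> z; rewrite mem_iota /= add0n ltnS => zy.
    have : y \in w by rewrite ew mem_cat inE yw2 !orbT.
    have ym : y != m by apply: contraNneq mw2 => <-.
    rewrite inw => ym1; have : z \in w by rewrite inw; lia.
    rewrite ew mem_cat inE => /or3P[/w21/(_ yw2)||//]; lia.
  by rewrite size_iota; apply; exact: iota_uniq.
have ge1 x : x \in w1 -> size w2 <= x.
  move=> xw1; have /uniq_leq_size : {subset w2 <= iota 0 x}.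
    by move=> y /(w21 _ _ xw1); rewrite mem_iota.
  by rewrite size_iota; apply.
have e1 : map (addn (size w2)) (map (subn^~ (size w2)) w1) = w1.
  rewrite -map_comp -[RHS]map_id; apply/eq_in_map => x /ge1 /=; lia.
have s12 : size w1 + size w2 = m by move: sw; rewrite ew size_cat /=; lia.
have [l el] : exists t, tword t = map (subn^~ (size w2)) w1.
  apply: IH; first by rewrite size_map; lia.
    apply/andP; split.
      by rewrite -(map_inj_uniq (@addnI (size w2))) e1.
    apply/allP => _ /mapP[x xw1 ->]; rewrite size_map.
    have : x \in w by rewrite ew mem_cat xw1.
    have : x != m by apply: contraNneq mw1 => <-.
    by have := ge1 _ xw1; rewrite inw; lia.
  apply: (@av132_addn (size w2)); rewrite e1; apply: av132_subseq av.
  by rewrite ew prefix_subseq.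
have [r er] : exists t, tword t = w2.
  apply: IH; first by lia.
    by rewrite /is_perm_word u2; apply/allP.
  apply: av132_subseq av.
  by rewrite ew -cat_rcons suffix_subseq.
exists (Node l r) => /=.
by rewrite -!size_tword el er e1 size_map s12.
Qed.

Definition perm_word n (s : 'S_n) : seq nat := [seq (s i : nat) | i <- enum 'I_n].

Lemma size_perm_word n (s : 'S_n) : size (perm_word s) = n.
Proof. by rewrite size_map size_enum_ord. Qed.

Lemma perm_word_inj n : injective (@perm_word n).
Proof.
move=> s t /eq_in_map st; apply/permP => i.
by apply: val_inj; apply: st; rewrite mem_enum.
Qed.

Lemma perm_wordP n (s : 'S_n) : is_perm_word (perm_word s).
Proof.
apply/andP; split.
  by rewrite map_inj_uniq ?enum_uniq // => i j /val_inj/perm_inj.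
by apply/allP => _ /mapP[i _ ->]; rewrite size_perm_word.
Qed.

Lemma perm_word_onto n w : is_perm_word w -> size w = n ->
  exists s : 'S_n, perm_word s = w.
Proof.
case/andP=> uw /allP bw sw.
have wn (i : 'I_n) : nth 0 w i < n by rewrite -[X in _ < X]sw bw ?mem_nth ?sw.
pose f i := Ordinal (wn i).
have f_inj : injective f.
  move=> i j /(congr1 val) /= /eqP.
  by rewrite nth_uniq ?sw // => /eqP/val_inj.
exists (perm f_inj); apply: (@eq_from_nth _ 0); first by rewrite size_perm_word.
move=> i; rewrite size_perm_word => iN.
rewrite (nth_map (Ordinal iN)) ?size_enum_ord // permE /=.
by rewrite nth_enum_ord.
Qed.

Lemma subword_subseq n (s : 'S_n) u :
  subseq u (perm_word s) <-> exists A : {set 'I_n}, subword s A = u.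
Proof.
split=> [/subseqP[m _ ->]|[A <-]]; last first.
  by apply: map_subseq; rewrite (enumT 'I_n) [enum A]/enum_mem filter_subseq.
exists [set i in mask m (enum 'I_n)]; rewrite /subword /perm_word -[RHS]map_mask.
congr (map _ _).
have /subseq_uniqP eM := mask_subseq m (enum 'I_n).
rewrite [RHS]eM ?enum_uniq // (enumT 'I_n) [LHS]/enum_mem.
by apply: eq_filter => i; rewrite /= inE.
Qed.

Lemma subseq_enum_ord n (t : seq 'I_n) :
  subseq t (enum 'I_n) <-> sorted ltn (map val t).
Proof.
have ltn_tr : transitive ltn by exact: ltn_trans.
have se : sorted ltn (map val (enum 'I_n)).
  by rewrite val_enum_ord iota_ltn_sorted.
split=> [/(map_subseq val)/subseq_sorted|st]; first by apply.
apply/subseq_uniqP; first exact: enum_uniq.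
apply: (inj_map val_inj); apply: (irr_sorted_eq ltn_tr ltnn) => //.
  apply: (subseq_sorted ltn_tr) se; apply: map_subseq; exact: filter_subseq.
move=> x; apply/mapP/mapP => -[i it ->]; exists i => //.
  by rewrite mem_filter it mem_enum.
by move: it; rewrite mem_filter => /andP[].
Qed.

Lemma containsP132 n (s : 'S_n) : reflect
  (exists i j k : 'I_n, [/\ i < j, j < k & s i < s k < s j]) (contains p132 s).
Proof.
pose o0 := @Ordinal 3 0 isT; pose o1 := @Ordinal 3 1 isT; pose o2 := @Ordinal 3 2 isT.
have t0 : p132 o0 = o0 by rewrite /p132 tpermD.
have t1 : p132 o1 = o2 by rewrite /p132 tpermL.
have t2 : p132 o2 = o1 by rewrite /p132 tpermR.
have ord3 (a : 'I_3) : [\/ a = o0, a = o1 | a = o2].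
  by case: a => [[|[|[|//]]]] p; 
    [constructor 1|constructor 2|constructor 3]; exact: val_inj.
apply: (iffP existsP) => [[f /andP[/forallP inc /forallP pat]]|].
  exists (f o0), (f o1), (f o2); split.
  - by have /forallP/(_ o1) := inc o0.
  - by have /forallP/(_ o2) := inc o1.
  - have /forallP/(_ o2)/eqP -> := pat o0.
    have /forallP/(_ o1)/eqP -> := pat o2.
    by rewrite t0 t1 t2.
move=> [i [j [k [ij jk /andP[ik kj]]]]].
exists [ffun a : 'I_3 => if a == o0 then i else if a == o1 then j else k].
apply/andP; split; apply/forallP => a; apply/forallP => b; rewrite !ffunE.
  by case: (ord3 a) => ->; case: (ord3 b) => -> //=; apply: ltn_trans jk.
case: (ord3 a) => ->; case: (ord3 b) => ->; rewrite ?t0 ?t1 ?t2 /=; lia.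
Qed.

Lemma in_Sav132 n (s : 'S_n) : s \in Sav n p132 <-> av132 (perm_word s).
Proof.
rewrite inE; split=> [/containsP132 av a b c|av].
  case/subseqP=> m _; rewrite -map_mask.
  case em: (mask m _) => [|i [|j [|k [|? ?]]]] //= [-> -> ->].
  apply/negP => ikj; apply: av; exists i, j, k.
  have /subseq_enum_ord := mask_subseq m (enum 'I_n).
  by rewrite em /= andbT => /andP[].
apply/containsP132 => -[i [j [k [ij jk ikj]]]].
have /(map_subseq (fun i => s i : nat))/av : subseq [:: i; j; k] (enum 'I_n).
  by apply/subseq_enum_ord; rewrite /= ij jk.
by rewrite ikj.
Qed.

(** * Repetitions of UUD, and sums over trees *)

Lemma size_flatten_UUD k : size (flatten (nseq k [:: U; U; D])) = 3 * k.
Proof. by elim: k => //= k ->; rewrite mulnS. Qed.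

Lemma nth_flatten_UUD k i : i < 3 * k ->
  nth false (flatten (nseq k [:: U; U; D])) i = (i %% 3 != 2).
Proof.
elim: k i => [|k IH] [|[|[|i]]] //= ik; rewrite IH; last by lia.
by congr (_ != _); lia.
Qed.

Lemma size_updown u : size (updown u) = (size u).-1.
Proof. by case: u => //= x u; rewrite size_pairmap. Qed.

Lemma nth_updown u i : i.+1 < size u ->
  nth false (updown u) i = (nth 0 u i < nth 0 u i.+1).
Proof. by case: u => //= x u iu; rewrite (nth_pairmap 0). Qed.

Lemma repeats_UUD u : repeats [:: U; U; D] u <->
  exists k, [/\ 0 < k, size u = (3 * k).+1 & uud u].
Proof.
split=> [[k k0 e]|[k [k0 su uu]]]; exists k => //.
  have := congr1 size e; rewrite size_updown size_flatten_UUD => su.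
  split=> // [|i iu]; first by lia.
  by rewrite -nth_updown // e nth_flatten_UUD //; lia.
apply: (@eq_from_nth _ false).
  by rewrite size_updown size_flatten_UUD su.
move=> i; rewrite size_updown su => iu.
by rewrite nth_updown ?su // nth_flatten_UUD ?uu ?su.
Qed.

(** Cutting an incomplete last copy of UUD costs at most two letters, and lengths below 4 contain no
    copy at all. The bounded error disappears on the linear scale. *)
Lemma longest_repeat_bounds n (s : 'S_n) t : tword t = perm_word s ->
  longest_repeat [:: U; U; D] s <= 3 * (maxuud t %/ 3) + 3 /\
  3 * (maxuud t %/ 3) <= longest_repeat [:: U; U; D] s + 3.
Proof.
move=> ts; split.
  apply/bigmax_leqP => A /asboolP/repeats_UUD[k [k0 sA uA]].
  have : reach (perm_word s) (size (subword s A)).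
    by apply: subseq_reach uA; apply/subword_subseq; exists A.
  by rewrite -ts reach_tword; lia.
case: (ltnP (maxuud t) 4) => M4; first by lia.
(* The largest [k] with [3 * k + 1 <= maxuud t]. *)
pose k := (maxuud t).-1 %/ 3.
have /reach_tword : (3 * k).+1 <= maxuud t by rewrite /k; lia.
rewrite ts => -[_ [/subword_subseq[A <-] sA uA]].
have : (3 * k).+1 <= longest_repeat [:: U; U; D] s.
  rewrite -sA; apply: (@leq_bigmax_cond _ _ (fun B => size (subword s B))).
  by apply/asboolP/repeats_UUD; exists k; split; rewrite // /k; lia.
have : maxuud t <= 3 * k + 3 by rewrite /k; lia.
by clearbody k; lia.
Qed.

(* The trees with [n] nodes and height at most [h]. *)
Fixpoint trees_fuel (h n : nat) : seq tree :=
  match h, n with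
  | _, 0 => [:: Leaf]
  | 0, _.+1 => [::]
  | h'.+1, n'.+1 =>
      flatten [seq [seq Node l r | l <- trees_fuel h' i, r <- trees_fuel h' (n' - i)]
              | i <- iota 0 n'.+1]
  end.

Definition trees (n : nat) : seq tree := trees_fuel n n.

Lemma trees_fuelE h n : n <= h -> trees_fuel h n = trees n.
Proof.
rewrite /trees; suff gen h1 h2 m : m <= h1 -> m <= h2 ->
  trees_fuel h1 m = trees_fuel h2 m by move=> nh; exact: gen.
elim: h1 h2 m => [|h1 IH] [|h2] [|m] //= mh1 mh2.
congr (_ ++ flatten _); first by rewrite !(IH h2) //; lia.
apply/eq_in_map => i; rewrite mem_iota => /andP[_ ni].
by rewrite !(IH h2) //; lia.
Qed.

Lemma trees0 : trees 0 = [:: Leaf]. Proof. by []. Qed.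

Lemma treesS n : trees n.+1 =
  flatten [seq [seq Node l r | l <- trees i, r <- trees (n - i)] | i <- iota 0 n.+1].
Proof.
rewrite {1}/trees /=; congr (_ ++ flatten _); first by rewrite !trees_fuelE ?subn0.
apply/eq_in_map => i; rewrite mem_iota => /andP[_ ni].
rewrite !trees_fuelE //; lia.
Qed.

Lemma mem_trees n t : (t \in trees n) = (nodes t == n).
Proof.
elim: t n => [|l IHl r IHr] [|n] //=.
  rewrite treesS; apply/negP => /flatten_mapP[i _ /allpairsP[p [_ _]]] //.
rewrite treesS eqSS; apply/flatten_mapP/eqP => [[i + /allpairsP[[l' r'] /=]]|e].
  rewrite mem_iota => ni [+ + [el er]].
  by rewrite -el -er IHl IHr => /eqP-> /eqP->; lia.
exists (nodes l); first by rewrite mem_iota; lia.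
by apply/allpairsP; exists (l, r); rewrite /= IHl IHr -e addKn !eqxx.
Qed.

Lemma flatten_uniq (T : eqType) (I : eqType) (F : I -> seq T) (s : seq I) :
  uniq s -> (forall i, i \in s -> uniq (F i)) ->
  (forall i j x, x \in F i -> x \in F j -> i = j) ->
  uniq (flatten (map F s)).
Proof.
move=> us uF dF; elim: s us uF => //= i s IH /andP[is_ us] uF.
rewrite cat_uniq uF ?mem_head // IH // ?andbT => [|j js]; last first.
  by rewrite uF // inE js orbT.
apply/hasPn => x /flatten_mapP[j js xj]; apply: contra is_ => xi.
by rewrite (dF _ _ _ xi xj).
Qed.

Lemma trees_uniq n : uniq (trees n).
Proof.
have [k] := ubnP n; elim: k n => // k IH [|n] //= nk; rewrite treesS.
apply: flatten_uniq; first exact: iota_uniq.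
  move=> i; rewrite mem_iota => ni; apply: allpairs_uniq; try by apply: IH; lia.
  by move=> [l r] [l' r'] _ _ [-> ->].
move=> i j _ /allpairsP[[l r] /= [li _ ->]] /allpairsP[[l' r'] /= [lj _ [el _]]].
by move: li lj; rewrite -el !mem_trees => /eqP-> /eqP.
Qed.

(** The inverse of [tword], found by search among the finitely many trees of the right size; the
    default [Leaf] is reached only on words outside the image of [tword]. *)
Definition word_tree (w : seq nat) : tree :=
  head Leaf [seq t <- trees (size w) | tword t == w].

Lemma twordK : cancel tword word_tree.
Proof.
move=> t; rewrite /word_tree size_tword.
rewrite (eq_filter (a2 := pred1 t)) => [|t' /=]; last by rewrite (inj_eq tword_inj).
by rewrite filter_pred1_uniq ?trees_uniq ?mem_trees.
Qed.

(** Change of variables along the bijection between permutations and trees. It serves both to count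
    [Sav n p132] and to average over it. *)
Lemma sum_Sav132 (V : nmodType) n (F : 'S_n -> V) (G : tree -> V) :
  (forall s t, tword t = perm_word s -> F s = G t) ->
  (\sum_(s in Sav n p132) F s = \sum_(t <- trees n) G t)%R.
Proof.
move=> FG; pose f s := word_tree (@perm_word n s).
have fK s : s \in Sav n p132 -> tword (f s) = perm_word s.
  by case/in_Sav132/(tword_onto (perm_wordP s)) => t ts; rewrite /f -ts twordK.
have /(perm_big _) <- : perm_eq (map f (enum (Sav n p132))) (trees n).
  apply: uniq_perm (trees_uniq n) _ => [|t].
    rewrite map_inj_in_uniq ?enum_uniq // => s s'.
    rewrite !mem_enum => /fK e /fK e' ss'.
    by apply: perm_word_inj; rewrite -e -e' ss'.
  rewrite mem_trees; apply/mapP/eqP => [[s]|tn].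
    rewrite mem_enum => /fK + ->; rewrite -size_tword => ->.
    by rewrite size_perm_word.
  have [|s st] := perm_word_onto (tword_perm t) (n := n); first by rewrite size_tword.
  exists s; last by rewrite /f st twordK.
  by rewrite mem_enum; apply/in_Sav132; rewrite st; exact: tword_av132.
rewrite big_map big_enum /=; apply: eq_bigr => s /fK.
exact: FG.
Qed.

(** * Convolutions and Catalan numbers *)

Local Open Scope classical_set_scope.
Local Open Scope ring_scope.

Definition conv (R : nzRingType) (a b : nat -> R) (n : nat) : R :=
  \sum_(i < n.+1) a i * b (n - i)%N.

(** The n-th coefficient sees only indices up to [n], so truncating to polynomials transports their
    commutativity and associativity to convolutions. *)
Lemma conv_poly (R : nzRingType) (a b : nat -> R) (N n : nat) : (n < N)%N ->
  conv a b n = ((\poly_(i < N) a i) * (\poly_(i < N) b i))`_n.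
Proof.
move=> nN; rewrite coefM; apply: eq_bigr => i _; rewrite !coef_poly.
have iN : (i < N)%N by have := ltn_ord i; lia.
have niN : (n - i < N)%N by lia.
by rewrite iN niN.
Qed.

Lemma convC (R : comNzRingType) (a b : nat -> R) n : conv a b n = conv b a n.
Proof. by rewrite !(conv_poly _ _ (ltnSn n)) mulrC. Qed.

Lemma convA (R : nzRingType) (a b c : nat -> R) n :
  conv a (conv b c) n = conv (conv a b) c n.
Proof.
have convl (x y z : nat -> R) : (forall i, (i <= n)%N -> x i = y i) ->
    conv x z n = conv y z n.
  by move=> xy; apply: eq_bigr => i _; rewrite xy // -ltnS.
have convr (x y z : nat -> R) : (forall i, (i <= n)%N -> x i = y i) ->
    conv z x n = conv z y n.
  by move=> xy; apply: eq_bigr => i _; rewrite xy // leq_subr.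
pose p x := \poly_(i < n.+1) (x i : R).
rewrite (convr (conv b c) (fun i => (p b * p c)`_i)) => [|i ni];
  last exact: (@conv_poly _ _ _ n.+1).
rewrite (convl (conv a b) (fun i => (p a * p b)`_i)) => [|i ni];
  last exact: (@conv_poly _ _ _ n.+1).
have -> : conv a (fun i => (p b * p c)`_i) n = (p a * (p b * p c))`_n.
  by rewrite coefM; apply: eq_bigr => i _; rewrite coef_poly ltn_ord.
have -> : conv (fun i => (p a * p b)`_i) c n = (p a * p b * p c)`_n.
  rewrite coefM; apply: eq_bigr => i _; rewrite coef_poly.
  by rewrite ifT // ltnS leq_subr.
by rewrite mulrA.
Qed.

Lemma conv_recl (R : nzRingType) (a b : nat -> R) n :
  conv a b n.+1 = a 0%N * b n.+1 + conv (fun i => a i.+1) b n.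
Proof. by rewrite /conv big_ord_recl subn0. Qed.

Lemma conv_recr (R : nzRingType) (a b : nat -> R) n :
  conv a b n.+1 = conv a (fun i => b i.+1) n + a n.+1 * b 0%N.
Proof.
rewrite /conv big_ord_recr /= subnn; congr (_ + _).
by apply: eq_bigr => i _; rewrite subSn // -ltnS.
Qed.

Lemma convZl (R : nzRingType) (k : R) (a b : nat -> R) n :
  conv (fun i => k * a i) b n = k * conv a b n.
Proof. by rewrite /conv mulr_sumr; apply: eq_bigr => i _; rewrite mulrA. Qed.

Lemma convZr (R : comNzRingType) (k : R) (a b : nat -> R) n :
  conv a (fun i => k * b i) n = k * conv a b n.
Proof. by rewrite convC convZl convC. Qed.

Lemma convDl (R : nzRingType) (a1 a2 b : nat -> R) n :
  conv (fun i => a1 i + a2 i) b n = conv a1 b n + conv a2 b n.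
Proof. by rewrite /conv -big_split; apply: eq_bigr => i _; rewrite mulrDl. Qed.

Lemma eq_conv (R : nzRingType) (a a' b b' : nat -> R) :
  a =1 a' -> b =1 b' -> conv a b =1 conv a' b'.
Proof. by move=> ea eb n; apply: eq_bigr => i _; rewrite ea eb. Qed.

Lemma series_conv (R : nzRingType) (x y : nat -> R) n :
  series (conv x y) n = \sum_(i < n) x i * series y (n - i)%N.
Proof.
elim: n => [|n IH]; first by rewrite /series /= big_geq // big_ord0.
rewrite seriesSr IH big_ord_recr /= subSnn.
rewrite /conv big_ord_recr /= subnn addrA -big_split /=; congr (_ + _).
  apply: eq_bigr => i _; rewrite -mulrDr subSn; last by rewrite ltnW.
  by rewrite seriesSr.
by rewrite seriesSr /series /= big_geq // add0r.
Qed.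

Lemma cvg_half (T : topologicalType) (u : nat -> T) (l : T) :
  u @ \oo --> l -> (fun n => u n./2) @ \oo --> l.
Proof.
move=> ul; apply: (cvg_comp _ _ _ ul).
apply/cvgnyPge => A; exists (A.*2)%N => // n /=; lia.
Qed.

Section TreeSums.
Variable R : realType.
Implicit Types x y : nat -> R.

Lemma series_ge0_le x m n : (forall i, 0 <= x i) -> (m <= n)%N ->
  series x m <= series x n.
Proof.
by move=> x0 mn; apply: (nondecreasing_series (P := xpredT)) => // i _ _.
Qed.

(* Both bounds come from summing over squares: the triangle [i + j < n]
   contains the square of side [n./2] and is contained in that of side [n]. *)
Lemma cvg_series_conv x y (X Y : R) :
  (forall n, 0 <= x n) -> (forall n, 0 <= y n) ->
  series x @ \oo --> X -> series y @ \oo --> Y ->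
  series (conv x y) @ \oo --> X * Y.
Proof.
move=> x0 y0 xX yY.
have sy0 n : 0 <= series y n by apply: sumr_ge0.
apply: (squeeze_cvgr (f := fun n => series x n./2 * series y n./2)
  (h := fun n => series x n * series y n)); last 2 first.
- by apply: cvgM; apply: cvg_half.
- exact: cvgM.
near=> n; rewrite series_conv; apply/andP; split.
  apply: (@le_trans _ _ (\sum_(i < n./2) x i * series y (n - i)%N)).
    rewrite {1}/series /= big_mkord mulr_suml; apply: ler_sum => i _.
    by apply: ler_wpM2l => //; apply: series_ge0_le => //; have := ltn_ord i; lia.
  rewrite -!(big_mkord xpredT (fun i => x i * series y (n - i)%N)).
  rewrite [leRHS](big_cat_nat (n := n./2)) //=; last by lia.
  by rewrite lerDl; apply: sumr_ge0 => i _; rewrite mulr_ge0.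
rewrite [in leRHS]/series /= big_mkord mulr_suml; apply: ler_sum => i _.
by apply: ler_wpM2l => //; apply: series_ge0_le => //; exact: leq_subr.
Unshelve. all: by end_near. Qed.

(* 4 is the growth rate of the Catalan numbers, so that [\sum_n treeP f n] is the
   value of the generating function of [f] at its critical point 1/4. *)
Definition treeP (f : tree -> R) (n : nat) : R :=
  (\sum_(t <- trees n) f t) / 4 ^+ n.

Lemma treeP0 f : treeP f 0 = f Leaf.
Proof. by rewrite /treeP trees0 big_seq1 expr0 divr1. Qed.

Lemma eq_treeP f g n : (forall t, f t = g t) -> treeP f n = treeP g n.
Proof. by move=> fg; congr (_ / _); apply: eq_bigr. Qed.

Lemma treePD f g n : treeP (fun t => f t + g t) n = treeP f n + treeP g n.
Proof. by rewrite /treeP big_split /= mulrDl. Qed.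

Lemma le_treeP f g n : (forall t, f t <= g t) -> treeP f n <= treeP g n.
Proof.
move=> fg; apply: ler_wpM2r; first by rewrite invr_ge0 exprn_ge0.
exact: ler_sum.
Qed.

Lemma treeP_ge0 f n : (forall t, 0 <= f t) -> 0 <= treeP f n.
Proof. by move=> f0; rewrite divr_ge0 ?exprn_ge0 ?sumr_ge0. Qed.

(** The weight [4 ^ n.+1] factors over the two subtrees and the root, which contributes [4^-1]. Two
    products and a remainder cover both additive functionals with toll [k] and the residue
    recursions. *)
Lemma treeP_Node (g1 h1 g2 h2 k f : tree -> R) n :
  (forall l r, f (Node l r) = g1 l * h1 r + g2 l * h2 r + k (Node l r)) ->
  treeP f n.+1 = 4^-1 * (conv (treeP g1) (treeP h1) n +
                         conv (treeP g2) (treeP h2) n) + treeP k n.+1.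
Proof.
move=> fE.
have E (F : tree -> R) : treeP F n.+1 = 4^-1 * \sum_(i < n.+1)
    (\sum_(l <- trees i) \sum_(r <- trees (n - i)) F (Node l r)) / 4 ^+ n.
  rewrite /treeP treesS big_flatten big_map -[iota 0 _]/(index_iota 0 n.+1).
  rewrite big_mkord exprS invfM mulrCA; congr (_ * _).
  rewrite -mulr_suml; congr (_ * _); apply: eq_bigr => i _.
  by rewrite big_allpairs_dep.
rewrite !E -mulrDr /conv -!big_split; congr (_ * _); apply: eq_bigr => i _ /=.
have prod (g h : tree -> R) : treeP g i * treeP h (n - i)%N =
    (\sum_(l <- trees i) \sum_(r <- trees (n - i)) g l * h r) / 4 ^+ n.
  have -> : 4 ^+ n = 4 ^+ i * 4 ^+ (n - i) :> R.
    by rewrite -exprD subnKC // -ltnS.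
  rewrite invfM mulrACA.
  by congr (_ * _); rewrite mulr_suml; apply: eq_bigr => l _; rewrite mulr_sumr.
rewrite !prod -!mulrDl; congr (_ * _).
rewrite -!big_split; apply: eq_bigr => l _ /=.
rewrite -!big_split; apply: eq_bigr => r _ /=.
exact: fE.
Qed.

(** The Catalan numbers divided by [4 ^ n]. *)
Definition cat4 : nat -> R := treeP (fun=> 1).

(* The central binomial coefficients [(n + 1) c_n], divided by [4 ^ n]. *)
Definition cbin4 (n : nat) : R := n.+1%:R * cat4 n.

Lemma cat4_0 : cat4 0 = 1. Proof. exact: treeP0. Qed.

Lemma cbin4_0 : cbin4 0 = 1. Proof. by rewrite /cbin4 cat4_0 mul1r. Qed.

Lemma cat4_ge0 n : 0 <= cat4 n. Proof. exact: treeP_ge0. Qed.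

Lemma treeP_cst0 n : treeP (fun=> 0) n = 0 :> R.
Proof. by rewrite /treeP big1 ?mul0r. Qed.

Lemma cat4S n : cat4 n.+1 = 4^-1 * conv cat4 cat4 n.
Proof.
rewrite {1}/cat4 (treeP_Node (g1 := fun=> 1) (h1 := fun=> 1) (g2 := fun=> 0)
  (h2 := fun=> 0) (k := fun=> 0)) => [|_ _]; last by rewrite !mul0r !mulr1 !addr0.
rewrite treeP_cst0 addr0 [X in _ + X]big1 ?addr0 // => i _.
by rewrite treeP_cst0 mul0r.
Qed.

(** In the Catalan recursion the weight [n + 2] splits as [(i + 1) + (n - i + 1)], and the two
    halves agree by symmetry. *)
Lemma cbin4S n : cbin4 n.+1 = 2^-1 * conv cbin4 cat4 n.
Proof.
have E : n.+2%:R * conv cat4 cat4 n = conv cbin4 cat4 n + conv cat4 cbin4 n.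
  rewrite /conv -big_split mulr_sumr; apply: eq_bigr => i _ /=.
  have -> : n.+2%:R = i.+1%:R + (n - i).+1%:R :> R.
    by rewrite -natrD; congr _%:R; have := ltn_ord i; lia.
  by rewrite /cbin4 mulrDl; congr (_ + _); [exact: mulrA|exact: mulrCA].
by rewrite /cbin4 cat4S mulrCA E [conv cat4 _ _]convC -/cbin4; field.
Qed.

(* In terms of generating functions, [B = 1 + 2xCB] and [C = 1 + xC^2]
   give [CB = 2B - C]. *)
Lemma conv_cat4_cbin4 n : conv cat4 cbin4 n = 2 * cbin4 n - cat4 n.
Proof.
case: n => [|n].
  by rewrite /conv big_ord1 cat4_0 cbin4_0; ring.
pose Y := conv cat4 (conv cat4 cbin4) n.
have E1 : conv cat4 cbin4 n.+1 = cbin4 n.+1 + 4^-1 * Y.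
  rewrite conv_recl cat4_0 mul1r /Y convA -convZl; congr (_ + _).
  by apply: eq_conv => // i; rewrite cat4S.
have E2 : conv cat4 cbin4 n.+1 = 2^-1 * Y + cat4 n.+1.
  rewrite conv_recr cbin4_0 mulr1 /Y -convZr; congr (_ + _).
  by apply: eq_conv => // i; rewrite cbin4S convC.
by lra.
Qed.

Lemma cbin4_rec n : cbin4 n.+1 = cbin4 n - cat4 n / 2.
Proof. by rewrite cbin4S convC conv_cat4_cbin4; field. Qed.

(** By [cbin4_rec] the series telescopes. *)
Lemma series_cat4 n : series cat4 n = 2 * (1 - cbin4 n).
Proof.
elim: n => [|n IH]; first by rewrite /series /= big_geq // cbin4_0 subrr mulr0.
by rewrite seriesSr IH cbin4_rec; field.
Qed.

Lemma cat4_gt0 n : 0 < cat4 n.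
Proof.
elim: n => [|n IH]; first by rewrite cat4_0.
have E : n.+2%:R * cat4 n.+1 = n.+1%:R * cat4 n - cat4 n / 2.
  exact: cbin4_rec.
have : 0 < n.+2%:R * cat4 n.+1.
  rewrite E -natr1 mulrDl mul1r.
  have : 0 <= n%:R * cat4 n by rewrite mulr_ge0 // ltW.
  by lra.
by rewrite pmulr_rgt0.
Qed.

Lemma cbin4_gt0 n : 0 < cbin4 n.
Proof. by rewrite mulr_gt0 ?cat4_gt0. Qed.

Lemma cbin4_le m n : (m <= n)%N -> cbin4 n <= cbin4 m.
Proof.
move=> /subnK <-; elim: (n - m)%N => // k; apply: le_trans.
rewrite addSn cbin4_rec.
by have := cat4_ge0 (k + m); lra.
Qed.

(** Consecutive terms have ratio [(2n + 1) / (2n + 2)], and [(2n + 1)(2n + 3) <= (2n + 2)^2]. This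
    gives decay of order [n^(-1/2)] without Stirling's formula. *)
Lemma cbin4_sqr n : cbin4 n ^+ 2 * n.*2.+1%:R <= 1.
Proof.
elim: n => [|n IH]; first by rewrite cbin4_0 expr1n mulr1.
have E : 2 * n.+1%:R * cbin4 n.+1 = n.*2.+1%:R * cbin4 n.
  by rewrite cbin4_rec /cbin4 -[n.*2.+1]addn1 -mul2n natrD natrM -natr1; field.
have E2 : (2 * n.+1%:R) ^+ 2 * cbin4 n.+1 ^+ 2 = n.*2.+1%:R ^+ 2 * cbin4 n ^+ 2.
  by rewrite -!exprMn E.
have n0 : 0 < (2 * n.+1%:R) ^+ 2 :> R by rewrite exprn_gt0 // mulr_gt0.
rewrite -(ler_pM2l n0) mulrA E2 mulr1.
apply: (@le_trans _ _ (n.*2.+1%:R * n.+1.*2.+1%:R)).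
  have -> : n.*2.+1%:R ^+ 2 * cbin4 n ^+ 2 * n.+1.*2.+1%:R =
      n.*2.+1%:R * n.+1.*2.+1%:R * (cbin4 n ^+ 2 * n.*2.+1%:R) by ring.
  by rewrite ler_piMr // mulr_ge0.
rewrite -!natrM -natrX ler_nat; lia.
Qed.

Lemma cvg_cbin4 : cbin4 @ \oo --> (0 : R).
Proof.
have sq : (fun n => cbin4 n ^+ 2) @ \oo --> (0 : R).
  apply: (squeeze_cvgr (f := fun=> 0) (h := harmonic)).
  - near=> n; rewrite sqr_ge0 /= /harmonic -[leRHS]mul1r ler_pdivlMr //.
    apply: le_trans (cbin4_sqr n); rewrite ler_wpM2l ?sqr_ge0 // ler_nat; lia.
  - exact: cvg_cst.
  - exact: cvg_harmonic.
apply/cvgr0Pnorm_lt => e e0.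
have /cvgr0Pnorm_lt/(_ (e ^+ 2)) := sq.
rewrite exprn_gt0 // => /(_ isT); apply: filterS => n.
rewrite !ger0_norm ?sqr_ge0 ?ltW ?cbin4_gt0 //.
by rewrite ltr_pXn2r // ?nnegrE ltW ?cbin4_gt0.
Unshelve. all: by end_near. Qed.


(** * Additive functionals of trees *)

Definition bounded01 (f : tree -> R) : Prop := forall t, 0 <= f t <= 1.

Definition treeV (f : tree -> R) : R := limn (series (treeP f)).

(** The partial sums increase and are dominated by those of the Catalan series, which stay below
    2. *)
Lemma cvg_treeV f : bounded01 f -> series (treeP f) @ \oo --> treeV f.
Proof.
move=> f01.
have f0 n : 0 <= treeP f n by apply: treeP_ge0 => t; case/andP: (f01 t).
apply: nondecreasing_is_cvgn => [m n mn|]; first exact: series_ge0_le.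
exists 2 => _ [n _ <-]; apply: (@le_trans _ _ (series cat4 n)).
  by apply: ler_sum => i _; apply: le_treeP => t; case/andP: (f01 t).
by rewrite series_cat4; have := ltW (cbin4_gt0 n); lra.
Qed.

Lemma treeVE f v : series (treeP f) @ \oo --> v -> treeV f = v.
Proof. exact: cvg_lim. Qed.

Lemma treeV1 : treeV (fun=> 1) = 2.
Proof.
apply: treeVE; rewrite (_ : series _ = fun n => 2 * (1 - cbin4 n)); last first.
  by apply/funext => n; rewrite -series_cat4.
rewrite -[X in _ --> X]mulr1 -[X in _ * X]subr0.
by apply: cvgMr; apply: cvgB; [exact: cvg_cst|exact: cvg_cbin4].
Qed.

Lemma treeV0 : treeV (fun=> 0) = 0.
Proof.
apply: treeVE; rewrite (_ : series _ = fun=> 0); first exact: cvg_cst.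
by apply/funext => n; rewrite /series /= big1 // => i _; rewrite treeP_cst0.
Qed.

Lemma treeVD f g : bounded01 f -> bounded01 g ->
  treeV (fun t => f t + g t) = treeV f + treeV g.
Proof.
move=> f01 g01; apply: treeVE.
rewrite (_ : series _ = fun n => series (treeP f) n + series (treeP g) n).
  by apply: cvgD; exact: cvg_treeV.
apply/funext => n; rewrite /series /= -big_split; apply: eq_bigr => i _ /=.
exact: treePD.
Qed.

(** At the critical point a recursion on the two subtrees becomes an algebraic equation between
    values of generating functions. *)
Lemma treeV_Node g1 h1 g2 h2 f :
  bounded01 g1 -> bounded01 h1 -> bounded01 g2 -> bounded01 h2 ->
  (forall l r, f (Node l r) = g1 l * h1 r + g2 l * h2 r) ->
  treeV f = f Leaf + 4^-1 * (treeV g1 * treeV h1 + treeV g2 * treeV h2).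
Proof.
(* The shift splits off the term of index 0, which is the contribution of [Leaf]. *)
move=> g1b h1b g2b h2b fE; apply: treeVE; rewrite -cvg_shiftS.
have ge0 g : bounded01 g -> forall n, 0 <= treeP g n.
  by move=> gb n; apply: treeP_ge0 => t; case/andP: (gb t).
rewrite (_ : [sequence _]_n = fun n => f Leaf + 4^-1 *
    (series (conv (treeP g1) (treeP h1)) n + series (conv (treeP g2) (treeP h2)) n)).
  apply: cvgD; first exact: cvg_cst.
  by apply: cvgMr; apply: cvgD; apply: cvg_series_conv;
    do ?[exact: ge0|exact: cvg_treeV].
apply/funext => n; rewrite /series /= big_nat_recl // treeP0; congr (_ + _).
rewrite -big_split mulr_sumr; apply: eq_bigr => i _ /=.
rewrite (treeP_Node (g1 := g1) (h1 := h1) (g2 := g2) (h2 := h2) (k := fun=> 0)).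
  by rewrite treeP_cst0 addr0.
by move=> l r; rewrite addr0 fE.
Qed.

(** Writing K and H for the generating functions of [K] and [h], K = H + 2xCK, hence K = HB, with B
    = 1 / (1 - 2xC) that of the central binomial coefficients. *)
Lemma treeP_additive (K h : tree -> R) n : K Leaf = h Leaf ->
  (forall l r, K (Node l r) = K l + K r + h (Node l r)) ->
  treeP K n = conv (treeP h) cbin4 n.
Proof.
move=> K0 KN; have [m] := ubnP n; elim: m n => // m IH [|n] nm.
  by rewrite treeP0 /conv big_ord1 treeP0 cbin4_0 mulr1 K0.
rewrite (treeP_Node (g1 := K) (h1 := fun=> 1) (g2 := fun=> 1) (h2 := K) (k := h)).
  rewrite [conv (treeP (fun=> 1)) _ _]convC -/cat4 conv_recr cbin4_0 mulr1.
  congr (_ + _).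
  have -> : conv (treeP K) cat4 n = conv (conv (treeP h) cbin4) cat4 n.
    by apply: eq_bigr => i _; rewrite IH //; have := ltn_ord i; lia.
  rewrite -convA (eq_conv (a' := treeP h)
    (b' := fun i => 2^-1 * conv cbin4 cat4 i) _ cbin4S) //.
  by rewrite convZr; field.
by move=> l r; rewrite mulr1 mul1r KN.
Qed.

(* The upper bound is the lower bound for the complementary toll [1 - h]. *)
Lemma treeP_additive_bounds (h : tree -> R) n : bounded01 h ->
  series (treeP h) n.+1 <= conv (treeP h) cbin4 n / cbin4 n
    <= 2 * cbin4 n.+1 + series (treeP h) n.+1.
Proof.
move=> h01.
(* [cbin4] decreases, so each factor [cbin4 (n - i)] is at least [cbin4 n]. *)
have lower (f : tree -> R) : bounded01 f ->
    series (treeP f) n.+1 <= conv (treeP f) cbin4 n / cbin4 n.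
  move=> f01; rewrite ler_pdivlMr ?cbin4_gt0 // /series /= big_mkord mulr_suml.
  apply: ler_sum => i _; apply: ler_wpM2l; last by apply: cbin4_le; exact: leq_subr.
  by apply: treeP_ge0 => t; case/andP: (f01 t).
rewrite lower //=.
pose h' t := 1 - h t.
have hD i : cat4 i = treeP h i + treeP h' i.
  by rewrite -treePD; apply: eq_treeP => t; rewrite /h' addrC subrK.
have /lower : bounded01 h' by move=> t; rewrite /h'; case/andP: (h01 t); lra.
have -> : series (treeP h') n.+1 = series cat4 n.+1 - series (treeP h) n.+1.
  by rewrite /series /= -sumrB; apply: eq_bigr => i _; rewrite hD addrC addKr.
have E : conv (treeP h) cbin4 n + conv (treeP h') cbin4 n = 2 * cbin4 n - cat4 n.
  by rewrite -convDl -conv_cat4_cbin4; apply: eq_conv.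
rewrite series_cat4 => lo.
have {}E : conv (treeP h') cbin4 n / cbin4 n =
    2 - cat4 n / cbin4 n - conv (treeP h) cbin4 n / cbin4 n.
  have b0 : cbin4 n != 0 by rewrite gt_eqF ?cbin4_gt0.
  have -> : conv (treeP h') cbin4 n = 2 * cbin4 n - cat4 n - conv (treeP h) cbin4 n.
    by rewrite -E addrC addKr.
  by field.
have : 0 <= cat4 n / cbin4 n by rewrite divr_ge0 ?ltW ?cbin4_gt0 ?cat4_gt0.
by move: lo; rewrite E; lra.
Qed.

(** Since [cbin4 n] is [n.+1%:R * cat4 n], the quotient is the mean of [K] over trees with [n]
    nodes, divided by [n + 1]. *)
Lemma cvg_treeP_additive (K h : tree -> R) : bounded01 h -> K Leaf = h Leaf ->
  (forall l r, K (Node l r) = K l + K r + h (Node l r)) ->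
  (fun n => treeP K n / cbin4 n) @ \oo --> treeV h.
Proof.
move=> h01 K0 KN.
have sh : (fun n => series (treeP h) n.+1) @ \oo --> treeV h.
  by rewrite (cvg_shiftS (series (treeP h))); exact: cvg_treeV.
apply: (squeeze_cvgr (f := fun n => series (treeP h) n.+1)
  (h := fun n => 2 * cbin4 n.+1 + series (treeP h) n.+1)) => //.
- by near=> n; rewrite (treeP_additive _ K0 KN) treeP_additive_bounds.
- rewrite -[X in _ --> X]add0r -[X in _ --> X + _](mulr0 2).
  apply: cvgD sh; apply: cvgMr.
  by rewrite (cvg_shiftS cbin4); exact: cvg_cbin4.
Unshelve. all: by end_near. Qed.

(** * Residues of [maxuud] at the critical point *)

Definition ind (p : tree -> bool) (t : tree) : R := (p t)%:R.

Lemma bounded01_ind p : bounded01 (ind p).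
Proof. by move=> t; rewrite /ind; case: (p t); rewrite ?lexx ler01. Qed.

Definition residue (e : nat) (t : tree) : bool := (maxuud t %% 3 == e)%N.

Definition toll (t : tree) : bool := if t is Node l r then residue 2 l else false.

(** Appending the maximum completes a block of three letters exactly at residue 2. The maximum in
    [push_below m1 m2] does not disturb the quotient: [m1] can win only if [m2 < 3]. *)
Lemma maxuud_div3_Node l r :
  (maxuud (Node l r) %/ 3 = maxuud l %/ 3 + maxuud r %/ 3 + toll (Node l r))%N.
Proof. by rewrite /= /residue /push_below /push_max; case: ifP; lia. Qed.

Let cst1_01 : bounded01 (fun=> 1). Proof. by move=> t; rewrite ler01 lexx. Qed.
Let cst0_01 : bounded01 (fun=> 0). Proof. by move=> t; rewrite ler01 lexx. Qed.

Lemma treeV_eq0 : treeV (ind (fun t => maxuud t == 0)%N) = 1.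
Proof.
rewrite (treeV_Node cst0_01 cst0_01 cst0_01 cst0_01) => [|l r]; last first.
  by rewrite mul0r addr0 /ind maxuud_eq0.
by rewrite treeV0 mul0r !addr0 mulr0 addr0.
Qed.

(** Such a word has no ascent, so a nonempty one has an empty left part and a right part of the same
    kind: v = 1 + v/4. *)
Lemma treeV_le1 : treeV (ind (fun t => maxuud t <= 1)%N) = 4 / 3.
Proof.
have := treeV_Node (bounded01_ind (fun t => maxuud t == 0)%N)
  (bounded01_ind (fun t => maxuud t <= 1)%N) cst0_01 cst0_01
  (f := ind (fun t => maxuud t <= 1)%N).
rewrite treeV_eq0 treeV0 [ind _ Leaf]/ind /= => E.
have {}E := E ltac:(move=> l r; rewrite mul0r addr0 /ind -natrM mulnb;
  congr (nat_of_bool _)%:R; rewrite /= /push_below /push_max; case: ifP; lia).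
by lra.
Qed.

Lemma treeV_eq1 : treeV (ind (fun t => maxuud t == 1)%N) = 3^-1.
Proof.
rewrite (treeV_Node (bounded01_ind (fun t => maxuud t == 0)%N)
  (bounded01_ind (fun t => maxuud t <= 1)%N) cst0_01 cst0_01).
  by rewrite treeV_eq0 treeV_le1 treeV0 /ind /=; field.
move=> l r; rewrite mul0r addr0 /ind -natrM mulnb.
by congr (nat_of_bool _)%:R; rewrite /= /push_below /push_max; case: ifP; lia.
Qed.

(* Here [maxuud r = 1], but [push_max (maxuud l) = 2 %[mod 3]] already gives one
   letter more, so the residue of [r] is not that of the whole tree. *)
Definition overshadowed (t : tree) : bool :=
  if t is Node l r then residue 1 l && (maxuud r == 1)%N else false.

(** Residue 1 is inherited from the right subtree, with two exceptions: the one-node tree gains it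
    and overshadowed trees lose it. Moving the latter to the left side gives v + v/12 = 1/4 +
    v/2. *)
Lemma treeV_residue1 : treeV (ind (residue 1)) = 3 / 7.
Proof.
have E1 : treeV (ind overshadowed) = 4^-1 * (treeV (ind (residue 1)) * 3^-1).
  rewrite (treeV_Node (bounded01_ind (residue 1))
    (bounded01_ind (fun t => maxuud t == 1)%N) cst0_01 cst0_01).
    by rewrite treeV_eq1 treeV0 /ind /= mul0r addr0 add0r.
  by move=> l r; rewrite mul0r addr0 /ind -natrM mulnb.
have := treeVD (bounded01_ind overshadowed) (bounded01_ind (residue 1)).
rewrite (treeV_Node (bounded01_ind (fun t => maxuud t == 0)%N)
  (bounded01_ind (fun t => maxuud t == 0)%N) cst1_01 (bounded01_ind (residue 1))).
  by rewrite treeV_eq0 treeV1 E1 /ind /=; lra.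
move=> l r; rewrite mul1r /ind -natrM mulnb -!natrD; congr _%:R.
by rewrite /= /residue /= /push_below /push_max; case: ifP; lia.
Qed.

(** Residue 2 comes from the right subtree, or from L n when L has residue 1 and R is too short to
    override it: v = (3/7 * 4/3 + 2v) / 4. *)
Lemma treeV_residue2 : treeV (ind (residue 2)) = 2 / 7.
Proof.
have := treeV_Node (bounded01_ind (residue 1))
  (bounded01_ind (fun t => maxuud t <= 1)%N) cst1_01 (bounded01_ind (residue 2))
  (f := ind (residue 2)).
rewrite treeV_residue1 treeV_le1 treeV1 [ind _ Leaf]/ind /= => E.
suff /E : forall l r, ind (residue 2) (Node l r) =
  ind (residue 1) l * ind (fun t => maxuud t <= 1)%N r + 1 * ind (residue 2) r by lra.
move=> l r; rewrite mul1r /ind -natrM mulnb -!natrD; congr _%:R.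
by rewrite /= /residue /= /push_below /push_max; case: ifP; lia.
Qed.

Lemma treeV_toll : treeV (ind toll) = 7^-1.
Proof.
rewrite (treeV_Node (bounded01_ind (residue 2)) cst1_01 cst0_01 cst0_01).
  by rewrite treeV_residue2 treeV1 treeV0 /ind /=; field.
by move=> l r; rewrite mul0r addr0 mulr1.
Qed.

End TreeSums.

(** * Expected length of the longest repetition *)

Theorem theorem1 (R : realType) :
  (fun n : nat =>
     Eav p132 (fun s : 'S_n => (longest_repeat [:: U; U; D] s)%:R : R)
       / (3 / 7 * n%:R)) @ \oo --> (1 : R).
Proof.
pose K t : R := (maxuud t %/ 3)%:R.
pose X n (s : 'S_n) : R := (longest_repeat [:: U; U; D] s)%:R.
pose E n := Eav p132 (@X n).
have a0 n : cat4 R n != 0 by rewrite gt_eqF ?cat4_gt0.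
have sumP f n : \sum_(t <- trees n) f t = 4 ^+ n * treeP f n :> R.
  by rewrite mulrCA divff ?mulr1 // expf_neq0.
have EX n : `|E n - 3 * (treeP K n / cat4 R n)| <= 3.
  have cS : #|Sav n p132|%:R = 4 ^+ n * cat4 R n.
    by rewrite -sumP -sum1_card natr_sum; apply: sum_Sav132.
  have -> : E n = (\sum_(s in Sav n p132) X n s) / #|Sav n p132|%:R.
    rewrite /E /Eav mulr_suml [RHS]big_mkcond; apply: eq_bigr => s _.
    by rewrite /Defs.uniform_prob; case: ifP => _; rewrite ?mul0r // mulrC.
  (* [K] is carried back to permutations, so that the two averages are compared term by term. *)
  pose Y (s : 'S_n) := K (word_tree (perm_word s)).
  have -> : treeP K n / cat4 R n = (\sum_(s in Sav n p132) Y s) / #|Sav n p132|%:R.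
    rewrite (sum_Sav132 (G := K)) ?sumP => [|s t st]; last by rewrite /Y -st twordK.
    by rewrite cS; field; rewrite a0 expf_neq0.
  have c0 : 0 < #|Sav n p132|%:R :> R by rewrite cS mulr_gt0 ?exprn_gt0 ?cat4_gt0.
  rewrite mulrA -mulrBl normrM [`|_^-1|]gtr0_norm ?invr_gt0 // ler_pdivrMr //.
  rewrite mulr_sumr -sumrB; apply: le_trans (ler_norm_sum _ _ _) _.
  rewrite -sum1_card natr_sum mulr_sumr; apply: ler_sum => s /in_Sav132.
  case/(tword_onto (perm_wordP s)) => t ts; rewrite mulr1 /X /Y -ts twordK /K.
  have [] := longest_repeat_bounds ts.
  by rewrite -!(ler_nat R) !natrD ler_norml => up lo; lra.
have cvgK : (fun n => treeP K n / cbin4 R n) @ \oo --> (7^-1 : R).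
  rewrite -treeV_toll; apply: cvg_treeP_additive (@bounded01_ind R toll) _ _ => // l r.
  by rewrite /K maxuud_div3_Node !natrD.
(* Main term plus error. The factor [1 + harmonic n] is [(n + 2) / (n + 1)], as [cbin4] normalises
   by one more than the size; the shift avoids the zero divisor at size 0. *)
have EK n : E n.+1 / (3 / 7 * n.+1%:R) =
    7 * (treeP K n.+1 / cbin4 R n.+1) * (1 + harmonic n) +
    7 / 3 * (E n.+1 - 3 * (treeP K n.+1 / cat4 R n.+1)) * harmonic n.
  rewrite /harmonic /cbin4 -[n.+2%:R]natr1.
  by rewrite /=; field; rewrite a0 nat1r natr1 !pnatr_eq0.
pose F n := E n / (3 / 7 * n%:R).
have e1 : 7 * 7^-1 * (1 + 0) + 0 = 1 :> R by field.
suff : F @ \oo --> (7 * 7^-1 * (1 + 0) + 0 : R) by rewrite e1.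
rewrite -cvg_shiftS (funext EK); apply: cvgD.
  apply: cvgM; last by apply: cvgD; [exact: cvg_cst|exact: cvg_harmonic].
  by apply: cvgMr; rewrite (cvg_shiftS (fun n => treeP K n / cbin4 R n)).
(* By [EX] the error is at most 3, whence 7 = 7/3 * 3. *)
apply/norm_cvg0P; apply: (squeeze_cvgr (f := fun=> 0) (h := fun n => 7 * harmonic n)).
- near=> n; rewrite normr_ge0 /= normrM [`|harmonic _|]ger0_norm;
    last exact: harmonic_ge0.
  rewrite ler_wpM2r ?harmonic_ge0 // normrM ger0_norm; last by lra.
  by have := EX n.+1; lra.
- exact: cvg_cst.
- by rewrite -[X in _ --> X](mulr0 7); apply: cvgMr; exact: cvg_harmonic.
Unshelve. all: by end_near. Qed.
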